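(* Let $n\ge 1$ be an integer and let $J$ be a countable set. For each $j\in J$, let $m_j$ be a positive integer and let $P_j:\mathbb{R}^{nm_j}\to\mathbb{R}$ be a not identically zero polynomial in $nm_j$ variables with rational coefficients. Assume that $d\ge 1$ is the maximum degree of the polynomials $P_j$ ($j\in J$). Then there exists a compact set $E\subset\mathbb{R}^n$ of Hausdorff dimension $n/d$ such that for every $j\in J$, $E$ does not contain $m_j$ distinct points $x_1,\ldots,x_{m_j}$ satisfying $P_j(x_1,\ldots,x_{m_j})=0$.
   Context: For a polynomial $P$ in $nm$ variables and points $x_1,\ldots,x_m\in\mathbb{R}^n$ with $x_i=(x_{i,1},\ldots,x_{i,n})$, $P(x_1,\ldots,x_m)$ means $P(x_{1,1},\ldots,x_{1,n},\ldots,x_{m,1},\ldots,x_{m,n})$. Degree means total degree. *)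

(* Defs.v *)
From HB Require Import structures.
From mathcomp Require Import all_boot all_order all_algebra.
From mathcomp Require Import all_classical all_reals all_analysis.
From mathcomp Require Import -(notations) mpoly.

Set Implicit Arguments.
Unset Strict Implicit.
Unset Printing Implicit Defensive.

Import Order.TTheory GRing.Theory Num.Theory.
Import numFieldNormedType.Exports.

Local Open Scope classical_set_scope.
Local Open Scope ring_scope.

(* The library norm on 'rV[R]_n is the sup norm, hence an explicit Euclidean
   distance. *)
Definition edist (R : realType) (n : nat) (x y : 'rV[R]_n) : R :=
  Num.sqrt (\sum_(i < n) (x 0 i - y 0 i) ^+ 2).

(* The max with 0 only serves to give the empty set diameter 0, not -oo. *)
Definition diam (R : realType) (n : nat) (A : set 'rV[R]_n) : \bar R :=
  maxe 0%E (ereal_sup [set (edist p.1 p.2)%:E | p in A `*` A]).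

Definition delta_cover (R : realType) (n : nat) (delta : R)
    (A : set 'rV[R]_n) (U : nat -> set 'rV[R]_n) : Prop :=
  A `<=` \bigcup_k U k /\ forall k, (diam (U k) <= delta%:E)%E.

(* Since 0 `^ 0 = 1, empty sets are left out of the sum: they contribute 0 also
   for s = 0, and finite covers are covers padded with empty sets. *)
Definition hausdorff_premeasure (R : realType) (n : nat) (s delta : R)
    (A : set 'rV[R]_n) : \bar R :=
  ereal_inf [set (\sum_(0 <= k <oo | U k != set0) poweR (diam (U k)) s)%E
            | U in delta_cover delta A].

Definition hausdorff_measure (R : realType) (n : nat) (s : R)
    (A : set 'rV[R]_n) : \bar R :=
  ereal_sup [set hausdorff_premeasure s delta A
            | delta in [set delta : R | 0 < delta]].

Definition hausdorff_dim (R : realType) (n : nat) (A : set 'rV[R]_n) : \bar R :=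
  ereal_inf [set s%:E
            | s in [set s : R | 0 <= s /\ hausdorff_measure s A = 0%E]].

(* The notations of mpoly are incompatible with those of MathComp-Analysis;
   mpoly k K is {mpoly K[k]}, and mmeasure mdeg is msize (degree + 1). *)
Definition total_degree (k : nat) (K : nzRingType) (p : mpoly k K) : nat :=
  (mmeasure mdeg p).-1.

(* mxvec lists the rows of a matrix one after the other, so the variables are
   evaluated at x_{1,1}, ..., x_{1,n}, ..., x_{m,1}, ..., x_{m,n}. *)
Definition eval_points (R : realType) (m n : nat)
    (p : mpoly (m * n) rat) (x : 'I_m -> 'rV[R]_n) : R :=
  meval (fun k => mxvec (\matrix_(i < m) x i) 0 k)
    (map_mpoly (@ratr R) p).

(* Main.v *)
(* The set [E] depends only on [n] and [d].  At stage [s] each cube of the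
   construction, of side close to [N_(s-1)^-d], is replaced by small cubes of
   side [2^-2s N_s^-d] placed at all points of the grid [N_s^-1 Z^n] inside it,
   where [N_s] grows so fast that the resulting dimension is [n/d].  In addition
   some of the small cubes (the descendants of one fixed earlier cube) are
   shifted along one coordinate by [t = 2^-s N_s^-d], each such choice being made
   at infinitely many stages.
   Let [P] have degree at most [d] and let [x_1, .., x_m] be distinct points of
   [E].  By induction on the degree, either [P] is constant or some partial
   derivative of [P] is nonzero at [x].  Shifting exactly the block and coordinate
   of that derivative moves the value of [P] at a tuple of grid points, which is a
   rational number with denominator [C N_s^d], by a nonzero amount much smaller
   than [N_s^-d], while passing from there to [x] matters even less; so [P] cannot
   vanish at [x].
   For the lower bound on the dimension, coding the cubes by base-2 expansions
   transports Lebesgue measure on [0, 1[ to [E]. *)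
Require Import Defs.
From HB Require Import structures.
From mathcomp Require Import all_boot all_order all_algebra.
From mathcomp Require Import all_classical all_reals all_analysis.
From mathcomp Require Import -(notations) mpoly.
From mathcomp Require Import ring lra zify.
Set Implicit Arguments.
Unset Strict Implicit.
Unset Printing Implicit Defensive.

Import Order.TTheory GRing.Theory Num.Theory.
Import numFieldNormedType.Exports.
Local Open Scope classical_set_scope.
Local Open Scope ring_scope.

(** * Rational polynomials near grid points *)

Section PolynomialFacts.

(** In characteristic zero a monomial with [m i != 0] survives in the [i]-th derivative, its
    coefficient being multiplied by [m i]. *)
Lemma constant_or_mderiv_neq0 (k : nat) (p : mpoly k rat) : p != 0 ->
  (exists2 c : rat, c != 0 & p = mpolyC k c) \/ exists i, mderiv i p != 0.
Proof.
move=> p0.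
have [/hasP[m m_p /existsP[i mi]]|/hasPn h] :=
    boolP (has (fun m : multinom k => [exists i, m i != 0%N]) (msupp p)).
  right; exists i; apply/eqP => /(congr1 (mcoeff (mnm_sub m (mnm1 i)))).
  rewrite mcoeff0 mcoeff_deriv submK ?lep1mP // => /eqP.
  rewrite mulrn_eq0 /= => /eqP pm0.
  by move: m_p; rewrite mcoeff_msupp pm0 eqxx.
left; have pm m : m != mnm0 -> mcoeff m p = 0.
  move=> m0; apply: memN_msupp_eq0; apply/negP => /h /negP; apply.
  apply: contraR m0 => /existsPn m0; apply/eqP/mnmP => i.
  by rewrite mnm0E; apply/eqP/negPn/m0.
have pE : p = mpolyC k (mcoeff mnm0 p).
  apply/mpolyP => m; rewrite mcoeffC.
  have [->|m0] := eqVneq m mnm0; first by rewrite mulr1.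
  by rewrite mulr0 pm.
by exists (mcoeff mnm0 p) => //; apply: contra_neq p0 => c0; rewrite pE c0 mpolyC0.
Qed.

Lemma msize_mderiv_lt (k : nat) (K : nzRingType) (p : mpoly k K) i :
  p != 0 -> (mmeasure mdeg (mderiv i p) < mmeasure mdeg p)%N.
Proof.
move=> p0; rewrite [X in (_ < X)%N]mpolySpred // ltnS [X in (X <= _)%N]mmeasureE.
apply/bigmax_leqP_seq => m; rewrite mcoeff_msupp mcoeff_deriv => mp _.
have : mnm_add m (mnm1 i) \in msupp p.
  by rewrite mcoeff_msupp; apply: contra_neq mp => ->; rewrite mul0rn.
move=> /msize_mdeg_lt; rewrite mdegD mdeg1 addn1 => h.
by rewrite -ltnS -mpolySpred.
Qed.

(** [C] clears the denominators of the coefficients and [N ^+ d] those of every monomial, whose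
    degree is at most [d] because [mmeasure mdeg] is the degree plus one. *)
Lemma meval_scaled_int (R : realType) (k : nat) (p : mpoly k rat) (d : nat) :
  (mmeasure mdeg p <= d.+1)%N -> exists2 C : nat, (0 < C)%N &
    forall (N : nat) (b : 'I_k -> R), (forall i, N%:R * b i \is a Num.int) ->
    C%:R * N%:R ^+ d * meval b (map_mpoly (@ratr R) p) \is a Num.int.
Proof.
move=> pd; pose C := (\prod_(m <- msupp p) `|denq (mcoeff m p)|)%N.
exists C.
  by rewrite prodn_gt0 // => m; rewrite absz_gt0 denq_neq0.
move=> N b Nb.
rewrite [in map_mpoly _ _](mpolyE p).
have mapD : {morph map_mpoly (@ratr R) : p q / p + q >-> (p + q : mpoly k R)}.
  exact: raddfD.
have map0 : map_mpoly (@ratr R) (0 : mpoly k rat) = 0 by exact: raddf0.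
rewrite (big_morph _ mapD map0) (big_morph _ (mevalD b) (meval0 b)) mulr_sumr.
rewrite big_seq; apply: rpred_sum => m mp.
rewrite map_mpolyZ map_mpolyX mevalZ mevalX.
have dm : (mdeg m <= d)%N by rewrite -ltnS (leq_trans _ pd) // msize_mdeg_lt.
rewrite mulrACA; apply: rpredM.
  rewrite /C (big_rem m mp) /= natrM mulrAC; apply: rpredM; last exact: rpred_nat.
  rewrite -[X in _ * ratr X]divq_num_den rmorphM /= fmorphV /= !ratr_int mulrCA.
  by rewrite natr_absz gtr0_norm ?denq_gt0 // divff ?mulr1 ?intr_eq0 ?denq_neq0 //.
rewrite -(subnK dm) exprD -mulrA; apply: rpredM.
  by apply: rpredX; exact: rpred_nat.
rewrite mdegE -prodrXr -big_split /=; apply: rpred_prod => i _.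
by rewrite -exprMn; apply: rpredX.
Qed.

(** First-order Taylor expansion with quadratic remainder; [M] depends on [x] and [p] but not on
    [h]. This form is stable under sums and products, so it spreads from constants and variables to
    all polynomials. *)
Definition has_taylor2 (R : realFieldType) (k : nat) (x : 'I_k -> R)
    (p : mpoly k R) : Prop :=
  exists2 M : R, 0 <= M & forall (eta : R) (h : 'I_k -> R), 0 <= eta <= 1 ->
    (forall i, `|h i| <= eta) ->
    `|meval (fun i => x i + h i) p - meval x p
      - \sum_i meval x (mderiv i p) * h i| <= M * eta ^+ 2.

Section Taylor.
Variables (R : realFieldType) (k : nat) (x : 'I_k -> R).

Lemma has_taylor2_const c : has_taylor2 x (mpolyC k c).
Proof.
exists 0 => // eta h _ _; rewrite !mevalC subrr sub0r normrN mul0r.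
by rewrite big1 ?normr0 // => i _; rewrite mderivC meval0 mul0r.
Qed.

Lemma has_taylor2_var j : has_taylor2 x (mpolyX R (mnm1 j)).
Proof.
exists 0 => // eta h _ _; rewrite !mevalXU mul0r normr_le0 (bigD1 j) //=.
have -> : mderiv j (mpolyX R (mnm1 j)) = 1.
    rewrite mderivX mnm1E eqxx scale1r -mpolyX0; congr mpolyX.
    by apply/mnmP => i; rewrite mnmBE subnn mnm0E.
rewrite meval1 mul1r big1; last first.
  by move=> i ij; rewrite mderivX mnm1E eq_sym (negbTE ij) scale0r meval0 mul0r.
by apply/eqP; ring.
Qed.

Lemma has_taylor2D p q :
  has_taylor2 x p -> has_taylor2 x q -> has_taylor2 x (p + q).
Proof.
move=> [M M0 pM] [L L0 qL]; exists (M + L); first exact: addr_ge0.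
move=> eta h eta01 hh.
have := lerD (pM _ _ eta01 hh) (qL _ _ eta01 hh); rewrite -mulrDl => le1.
apply: le_trans le1; apply: le_trans (ler_normD _ _).
rewrite le_eqVlt; apply/orP; left; apply/eqP; congr (`|_|).
rewrite !mevalD; under eq_bigr do rewrite mderivD mevalD mulrDl.
by rewrite big_split /=; ring.
Qed.

Lemma has_taylor2M p q :
  has_taylor2 x p -> has_taylor2 x q -> has_taylor2 x (p * q).
Proof.
move=> [M M0 pM] [L L0 qL].
pose A := \sum_i `|meval x (mderiv i p)|.
pose B := \sum_i `|meval x (mderiv i q)|.
have A0 : 0 <= A by exact: sumr_ge0.
have B0 : 0 <= B by exact: sumr_ge0.
exists (A * B + M * (`|meval x q| + B + L) + L * (`|meval x p| + A)).
  by rewrite !addr_ge0 ?mulr_ge0 ?addr_ge0.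
move=> eta h /andP[eta0 eta1] hh.
have eta01 : 0 <= eta <= 1 by rewrite eta0.
have lin (r : mpoly k R) : `|\sum_i meval x (mderiv i r) * h i| <=
    (\sum_i `|meval x (mderiv i r)|) * eta.
  apply: le_trans (ler_norm_sum _ _ _) _; rewrite mulr_suml; apply: ler_sum => i _.
  by rewrite normrM ler_wpM2l.
have := lin p; have := lin q; have := pM _ _ eta01 hh; have := qL _ _ eta01 hh.
rewrite !mevalM.
have -> : \sum_i meval x (mderiv i (p * q)) * h i =
    meval x q * (\sum_i meval x (mderiv i p) * h i) +
    meval x p * (\sum_i meval x (mderiv i q) * h i).
  rewrite !mulr_sumr -big_split /=; apply: eq_bigr => i _.
  by rewrite mderivM mevalD !mevalM; ring.
rewrite -/A -/B.
move: (\sum_i meval x (mderiv i p) * h i) (\sum_i meval x (mderiv i q) * h i) => dp dq.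
move: (meval _ p) (meval _ q) (meval x p) (meval x q) => P' Q' P Q.
set f := Q' - Q - dq; set e := P' - P - dp => hf he hdq hdp.
(* The term [dp * dq] is quadratic since both factors are linear in [h]; the others carry a
   remainder [e] or [f], with cofactors bounded because [eta <= 1]. *)
have -> : P' * Q' - P * Q - (Q * dp + P * dq) =
   dp * dq + e * (Q + dq + f) + f * (P + dp) by rewrite /e /f; ring.
have eta2 : eta ^+ 2 <= 1 by rewrite exprn_ile1.
clearbody e f; rewrite !mulrDl; apply: le_trans (ler_normD _ _) _.
apply: lerD; last first.
  rewrite normrM mulrAC; apply: ler_pM => //.
  apply: le_trans (ler_normD _ _) _; rewrite lerD2l.
  by apply: le_trans hdp _; rewrite ler_piMr.
apply: le_trans (ler_normD _ _) _; apply: lerD.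
  by rewrite normrM expr2 mulrACA; apply: ler_pM.
rewrite normrM mulrAC; apply: ler_pM => //.
apply: le_trans (ler_normD _ _) _; apply: lerD.
  apply: le_trans (ler_normD _ _) _; rewrite lerD2l.
  by apply: le_trans hdq _; rewrite ler_piMr.
by apply: le_trans hf _; rewrite ler_piMr.
Qed.

Lemma has_taylor2_mpoly p : has_taylor2 x p.
Proof.
elim/mpolyind: p => [|c m p _ _ IH]; first by rewrite -mpolyC0; exact: has_taylor2_const.
apply: has_taylor2D IH; rewrite -mul_mpolyC; apply: has_taylor2M.
  exact: has_taylor2_const.
rewrite mpolyXE_id; apply: (big_ind (has_taylor2 x)).
- by rewrite -mpolyC1; exact: has_taylor2_const.
- exact: has_taylor2M.
- move=> i _; elim: (m i) => [|j IH].
    by rewrite expr0 -mpolyC1; exact: has_taylor2_const.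
  by rewrite exprS; apply: has_taylor2M => //; exact: has_taylor2_var.
Qed.

End Taylor.

Lemma map_mpoly_mderiv (k : nat) (K L : nzRingType) (f : {rmorphism K -> L}) i
    (p : mpoly k K) : map_mpoly f (mderiv i p) = mderiv i (map_mpoly f p).
Proof.
by apply/mpolyP => m; rewrite mcoeff_map_mpoly !mcoeff_deriv mcoeff_map_mpoly raddfMn.
Qed.

(* If the value at [x] were 0, then [C N^d] times the value at the grid point
   [b] would be an integer which is close to [C N^d t] times the partial
   derivative: too small to be nonzero, but too precisely known to be zero. *)
Lemma shifted_grid_point_neq0 (R : realType) (k : nat) (p : mpoly k rat)
    (d : nat) (x : 'I_k -> R) (l : 'I_k) :
  (mmeasure mdeg p <= d.+1)%N ->
  meval x (map_mpoly (@ratr R) (mderiv l p)) != 0 ->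
  exists2 eps : R, 0 < eps & forall (N : nat) (t rho : R) (b : 'I_k -> R),
    (0 < N)%N -> 0 < t <= eps -> rho <= eps * t -> t * N%:R ^+ d <= eps ->
    (forall i, N%:R * b i \is a Num.int) ->
    (forall i, 0 <= x i - b i - (i == l)%:R * t <= rho) ->
    meval x (map_mpoly (@ratr R) p) != 0.
Proof.
move=> pd; set q := map_mpoly _ p => dlp.
have [C C0 Cint] := @meval_scaled_int R k p d pd.
have [M M0 Mq] := has_taylor2_mpoly x q.
pose G := \sum_i `|meval x (mderiv i q)|.
have G0 : 0 <= G by exact: sumr_ge0.
move: dlp; rewrite map_mpoly_mderiv -/q; set D := meval x (mderiv l q) => D0.
have D0' : 0 < `|D| by rewrite normr_gt0.
pose W := `|D| + G + 4 * M.
have W0 : 0 < W by rewrite /W; lra.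
(* The entry [2^-1] keeps [b - x] within [2 * t <= 1]; the second makes all errors smaller than
   [|D| * t], so that the value at [b] is nonzero. The bound [(C%:R * W * 2)^-1] added below makes
   that value times [C * N ^ d] at most 1/2. *)
pose e1 := Num.min (2^-1) (`|D| / (2 * W)).
have C0' : 0 < C%:R * W * 2 :> R by rewrite !mulr_gt0 ?ltr0n.
exists (Num.min e1 (C%:R * W * 2)^-1).
  by rewrite !lt_min !divr_gt0 ?invr_gt0 ?mulr_gt0 //= ?ltr0n.
move=> N t rho b N0 /andP[t0]; rewrite !le_min => /andP[/andP[t1 t2] _].
have rle : Num.min e1 (C%:R * W * 2)^-1 * t <= t / 2.
  rewrite mulrC ler_wpM2l ?(ltW t0) // !ge_min; apply/orP; left; apply/orP; left.
  by [].
have rle2 : Num.min e1 (C%:R * W * 2)^-1 * t <= `|D| / (2 * W) * t.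
  by rewrite ler_wpM2r ?(ltW t0) // !ge_min lexx ?orbT.
move=> rho1 /andP[_ tN] Nb xb; apply/negP => /eqP qx0.
have {rle} rhot : rho <= t / 2 by exact: le_trans rle.
have {rle2} rhoD : rho <= `|D| / (2 * W) * t by exact: le_trans rle2.
pose h i := b i - x i.
have hh i : `|h i + (i == l)%:R * t| <= rho.
  have /andP[h1 h2] := xb i; rewrite ler_norml /h; apply/andP; split; lra.
have rho0 : 0 <= rho by apply: le_trans (hh l); exact: normr_ge0.
have h2t i : `|h i| <= 2 * t.
  have := hh i; rewrite !ler_norml => /andP[].
  by case: (i == l); rewrite ?mul0r ?mul1r => ? ?; apply/andP; split; lra.
have t21 : 0 <= 2 * t <= 1.
  by apply/andP; split; lra.
have := Mq _ _ t21 h2t; rewrite qx0 subr0.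
have -> : meval (fun i => x i + h i) q = meval b q.
  by apply: meval_eq => i; rewrite /h addrC subrK.
have lin : `|\sum_i meval x (mderiv i q) * h i + D * t| <= G * rho.
  have -> : D * t = \sum_i meval x (mderiv i q) * ((i == l)%:R * t).
    rewrite (bigD1 l) //= eqxx mul1r big1 ?addr0 // => i /negbTE ->.
    by rewrite mul0r mulr0.
  rewrite -big_split /=; apply: le_trans (ler_norm_sum _ _ _) _.
  by rewrite mulr_suml; apply: ler_sum => i _; rewrite -mulrDr normrM ler_wpM2l.
move=> tay.
have dist : `|meval b q + D * t| <= G * rho + M * (2 * t) ^+ 2.
  apply: le_trans (lerD lin tay); rewrite [leRHS]addrC; apply: le_trans (ler_normD _ _).
  by rewrite le_eqVlt; apply/orP; left; apply/eqP; congr (`|_|); ring.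
have bq0 : meval b q != 0.
  apply/eqP => b0; move: dist; rewrite b0 add0r normrM (gtr0_norm t0) leNgt.
  move=> /negP; apply.
  have Wlt : (G + 4 * M) * (`|D| / (2 * W)) < `|D|.
    rewrite mulrA ltr_pdivrMr ?mulr_gt0 // mulrC ltr_pM2l // /W.
    move: M0 G0; lra.
  have := ler_wpM2l G0 rhoD.
  have : M * (2 * t) ^+ 2 <= 4 * M * (`|D| / (2 * W)) * t.
    have -> : M * (2 * t) ^+ 2 = 4 * M * t * t by ring.
    by rewrite ler_wpM2r ?(ltW t0) // ler_wpM2l ?mulr_ge0.
  have : (G + 4 * M) * (`|D| / (2 * W)) * t < `|D| * t by rewrite ltr_pM2r.
  move: (`|D| / (2 * W)) => z; lra.
have bq1 : `|meval b q| <= t * W.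
  have := ler_normB (meval b q + D * t) (D * t); rewrite addrK => /le_trans; apply.
  rewrite normrM (gtr0_norm t0).
  apply: le_trans (lerD dist (lexx _)) _; rewrite /W.
  have h1 : G * rho <= G * t by rewrite ler_wpM2l //; lra.
  have h2 : M * (2 * t) ^+ 2 <= 4 * M * t.
    have -> : M * (2 * t) ^+ 2 = 4 * M * t * t by ring.
    have ? : t <= 1 by lra.
    by rewrite ler_piMr // ?mulr_ge0 // ltW.
  lra.
have := Cint N b Nb; rewrite -/q => /norm_intr_ge1.
have CN0 : C%:R * N%:R ^+ d != 0 :> R.
  by rewrite mulf_neq0 ?expf_neq0 ?pnatr_eq0 -?lt0n.
rewrite mulf_neq0 // => /(_ isT); rewrite leNgt => /negP; apply.
rewrite normrM ger0_norm ?mulr_ge0 ?exprn_ge0 //.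
have CNp : 0 < C%:R * N%:R ^+ d :> R by rewrite mulr_gt0 ?exprn_gt0 ?ltr0n.
apply: le_lt_trans (_ : C%:R * N%:R ^+ d * (t * W) < 1).
  by rewrite ler_wpM2l ?(ltW CNp).
have -> : C%:R * N%:R ^+ d * (t * W) = C%:R * W * (t * N%:R ^+ d) by ring.
apply: le_lt_trans (_ : C%:R * W * (C%:R * W * 2)^-1 < 1).
  by rewrite ler_wpM2l // mulr_ge0 // ltW.
have CW : C%:R * W != 0 by rewrite mulf_neq0 ?pnatr_eq0 -?lt0n // gt_eqF.
by rewrite invfM mulrA mulfV // mul1r invf_lt1 // ltr1n.
Qed.

End PolynomialFacts.

(** * Growth of the scales *)

Section Exponents.
Variable d : nat.

(* At level [s] the grid has step [2 ^ - grid_exp s], cells have side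
   [2 ^ - side_exp s], shifts have length [2 ^ - shift_exp s], every cell has
   [2 ^ (n * branch_exp s)] children, and there are [2 ^ (n * total_exp s)]
   cells. *)
Fixpoint grid_exp (s : nat) : nat :=
  if s is s'.+1 then ((2 * s' + d + 3) * (grid_exp s').+1)%N else 0%N.
Definition side_exp (s : nat) : nat := (d * grid_exp s + 2 * s)%N.
Definition shift_exp (s : nat) : nat := (d * grid_exp s + s)%N.
Definition branch_exp (s : nat) : nat := (grid_exp s.+1 - side_exp s)%N.
Fixpoint total_exp (s : nat) : nat :=
  if s is s'.+1 then (total_exp s' + branch_exp s')%N else 0%N.

Lemma side_exp_lt_grid_exp s : (side_exp s + 3 <= grid_exp s.+1)%N.
Proof. rewrite /side_exp /=; nia. Qed.

Lemma branch_expE s : (side_exp s + branch_exp s = grid_exp s.+1)%N.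
Proof. rewrite /branch_exp; have := side_exp_lt_grid_exp s; lia. Qed.

Lemma shift_exp_le_side_exp s : (shift_exp s + s = side_exp s)%N.
Proof. rewrite /side_exp /shift_exp; lia. Qed.

Lemma leq_side_exp s : (s <= side_exp s)%N.
Proof. rewrite /side_exp; lia. Qed.

Lemma leq_grid_exp s : (s <= grid_exp s)%N.
Proof. elim: s => //= s IH; nia. Qed.

(** The admissible factors [a] grow with [s], so [grid_exp s] becomes negligible against
    [grid_exp s.+1]; the lower bound on the dimension rests on this. *)
Lemma leq_mul_grid_exp a s : (a <= 2 * s + d + 3)%N ->
  (a * (grid_exp s).+1 <= grid_exp s.+1)%N.
Proof. by move=> h; rewrite leq_mul2r h orbT. Qed.

Lemma grid_exp_mono s s' : (s <= s')%N -> (grid_exp s <= grid_exp s')%N.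
Proof.
move=> /subnK <-; elim: (s' - s)%N => // m IH; apply: leq_trans IH _.
rewrite addSn /=; nia.
Qed.

Lemma total_exp_mono s s' : (s <= s')%N -> (total_exp s <= total_exp s')%N.
Proof.
move=> /subnK <-; elim: (s' - s)%N => // m IH; apply: leq_trans IH _.
exact: leq_addr.
Qed.

Hypothesis d_gt0 : (0 < d)%N.

Lemma grid_exp_le_shift_exp s : (grid_exp s + s <= shift_exp s)%N.
Proof. rewrite /shift_exp; nia. Qed.

(** One step adds [grid_exp s.+1 - side_exp s] to [total_exp s], and
    [total_exp s <= grid_exp s <= side_exp s]. This bound on the number of cells gives the upper
    bound on the dimension. *)
Lemma total_exp_le_grid_exp s : (total_exp s <= grid_exp s)%N.
Proof.
elim: s => //= s IH; have := branch_expE s; have := grid_exp_le_shift_exp s.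
have := shift_exp_le_side_exp s; rewrite /=; lia.
Qed.

End Exponents.

(** Each 2-adic valuation is attained at infinitely many stages, so every task, coded by a number,
    recurs; valuations that code no task give [(0, 0, 0)]. *)
Definition task (s : nat) : nat * nat * nat :=
  odflt (0, 0, 0)%N (unpickle (logn 2 s)).

Lemma task_recurs (t : nat * nat * nat) (S : nat) :
  exists2 s, (S <= s)%N & task s = t.
Proof.
exists (2 ^ pickle t * (2 * S).+1)%N.
  by apply: leq_trans (leq_pmull _ _); [lia|rewrite expn_gt0].
rewrite /task lognM ?expn_gt0 // pfactorK // lognE.
have -> : (2 %| (2 * S).+1)%N = false by rewrite dvdn2 /= mul2n odd_double.
by rewrite !andbF addn0 pickleK.
Qed.

(** * The cells and the compact set *)

Section Cells.
Variables (R : realType) (n d : nat).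
Hypothesis d_gt0 : (0 < d)%N.

Local Notation e := (grid_exp d).
Local Notation f := (side_exp d).
Local Notation g := (shift_exp d).
Local Notation br := (branch_exp d).
Local Notation T := (total_exp d).
Local Notation half := (2^-1 : R).

(* The cells of level [s] are numbered by [c < 2 ^ (n * T s)]: dividing [c] by
   the number of children of a cell gives the number of its parent, and the [n]
   lowest digits of [c] in base [2 ^ br] give its position on the grid inside the
   parent.  At level 0 there is only the unit cube. *)
Definition parent (s c : nat) : nat := (c %/ 2 ^ (n * br s))%N.
Definition ancestor (s w c : nat) : nat := (c %/ 2 ^ (n * (T s - T w)))%N.
Definition digit (s c k : nat) : nat := ((c %/ 2 ^ (br s * k)) %% 2 ^ br s)%N.
(* The task [(w, c0, k0)] of stage [s] is to shift the descendants of the cell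
   [c0] of level [w] along coordinate [k0]. *)
Definition shifted (s c k : nat) : bool :=
  let: (w, c0, k0) := task s in
  [&& (w <= s)%N, ancestor s w c == c0 & k == k0].

Fixpoint corner (s c k : nat) : R :=
  if s is s'.+1 then
    corner s' (parent s' c) k + (digit s' c k)%:R * half ^+ e s
    + (shifted s c k)%:R * half ^+ g s
  else 0.
(** The corner of the cell [c] of level [s.+1], not [s], before its possible shift. *)
Definition grid_point (s c k : nat) : R :=
  corner s (parent s c) k + (digit s c k)%:R * half ^+ e s.+1.

Definition cell (s c : nat) : set 'rV[R]_n :=
  [set x | forall k : 'I_n, corner s c k <= x 0 k <= corner s c k + half ^+ f s].

Lemma half_gt0 m : 0 < half ^+ m.
Proof. by rewrite exprn_gt0 // invr_gt0. Qed.

Lemma half_ge0 m : 0 <= half ^+ m.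
Proof. exact: ltW (half_gt0 m). Qed.

Lemma half_mono a b : (a <= b)%N -> half ^+ b <= half ^+ a.
Proof. by move=> ab; apply: ler_wiXn2l => //; rewrite ?invr_ge0 ?invf_le1 ?ler1n. Qed.

Lemma two_halfK m : 2 ^+ m * half ^+ m = 1.
Proof. by rewrite -exprMn divff ?expr1n ?pnatr_eq0. Qed.

Lemma half_expB a b : (a <= b)%N -> 2 ^+ a * half ^+ b = half ^+ (b - a).
Proof. by move=> ab; rewrite -{1}(subnKC ab) exprD mulrA two_halfK mul1r. Qed.

Lemma digit_lt s c k : (digit s c k < 2 ^ br s)%N.
Proof. by rewrite ltn_mod expn_gt0. Qed.

Lemma corner_int s c k : 2 ^+ g s * corner s c k \is a Num.int.
Proof.
elim: s c => [|s IH] c; first by rewrite mulr0.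
rewrite [corner _ _ _]/= !mulrDr; apply: rpredD; last first.
  by rewrite mulrCA two_halfK mulr1 rpred_nat.
have eg : (e s.+1 <= g s.+1)%N by have := grid_exp_le_shift_exp d_gt0 s.+1; lia.
apply: rpredD; last first.
  rewrite mulrCA -{1}(subnK eg) exprD -mulrA two_halfK mulr1.
  by apply: rpredM; rewrite ?rpred_nat ?rpredX ?rpred_nat.
have gg : (g s <= g s.+1)%N.
  have := side_exp_lt_grid_exp d s; have := shift_exp_le_side_exp d s; lia.
rewrite -(subnK gg) exprD -mulrA; apply: rpredM; last exact: IH.
by rewrite rpredX ?rpred_nat.
Qed.

(** Earlier shifts do no harm: corners of level [s] are multiples of [half ^+ g s], and
    [g s <= e s.+1]. *)
Lemma grid_point_int s c k : 2 ^+ e s.+1 * grid_point s c k \is a Num.int.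
Proof.
rewrite /grid_point mulrDr; apply: rpredD; last first.
  by rewrite mulrCA two_halfK mulr1 rpred_nat.
have ge : (g s <= e s.+1)%N.
  have := side_exp_lt_grid_exp d s; have := shift_exp_le_side_exp d s; lia.
rewrite -(subnK ge) exprD -mulrA; apply: rpredM; last exact: corner_int.
by rewrite rpredX ?rpred_nat.
Qed.

(** Keeps even a shifted cell inside the grid box of its grid point, whence nesting and disjointness
    of cells. *)
Lemma shift_side_lt s : half ^+ g s.+1 + half ^+ f s.+1 < half ^+ e s.+1.
Proof.
have := grid_exp_le_shift_exp d_gt0 s.+1; have := shift_exp_le_side_exp d s.+1.
move=> h1 h2.
have := @half_mono (e s.+1).+1 (g s.+1) ltac:(lia).
have := @half_mono (e s.+1).+2 (f s.+1) ltac:(lia).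
rewrite !exprS; have := half_gt0 (e s.+1); lra.
Qed.

Lemma grid_point_bounds s c k :
  [/\ corner s (parent s c) k <= grid_point s c k,
      grid_point s c k + half ^+ e s.+1 <= corner s (parent s c) k + half ^+ f s
    & grid_point s c k <= corner s.+1 c k <= grid_point s c k + half ^+ g s.+1].
Proof.
rewrite /grid_point; split.
- by rewrite lerDl mulr_ge0 ?half_ge0 ?ler0n.
- rewrite -addrA lerD2l.
  have -> : half ^+ f s = 2 ^+ br s * half ^+ e s.+1.
    by rewrite half_expB -branch_expE ?addnK ?leq_addl.
  rewrite -[X in _ + X]mul1r -mulrDl ler_wpM2r ?half_ge0 //.
  by rewrite natr1 -natrX ler_nat digit_lt.
- rewrite [corner s.+1 c k]/= lerDl lerD2l mulr_ge0 ?half_ge0 ?ler0n //=.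
  by case: shifted; rewrite ?mul1r ?mul0r // half_ge0.
Qed.

Lemma cell_grid_point s c x (k : 'I_n) : cell s.+1 c x ->
  grid_point s c k <= x 0 k < grid_point s c k + half ^+ e s.+1.
Proof.
move=> /(_ k); have [_ _] := grid_point_bounds s c k.
have := shift_side_lt s; lra.
Qed.

Lemma cell_corner_nested s c k :
  corner s (parent s c) k <= corner s.+1 c k
  /\ corner s.+1 c k + half ^+ f s.+1 <= corner s (parent s c) k + half ^+ f s.
Proof.
have [h1 h2 h3] := grid_point_bounds s c k; have := shift_side_lt s.
by move=> h4; split; lra.
Qed.

Lemma cell_parent s c : cell s.+1 c `<=` cell s (parent s c).
Proof.
move=> x xc k; have := xc k; have [] := cell_corner_nested s c k; lra.
Qed.

Lemma ancestorS s w c : (w <= s)%N -> ancestor s.+1 w c = ancestor s w (parent s c).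
Proof.
move=> ws; rewrite /ancestor /parent -divnMA -expnD; congr (_ %/ 2 ^ _)%N.
by rewrite /= -addnBAC ?total_exp_mono // mulnDr addnC.
Qed.

Lemma cell_ancestor s w c : (w <= s)%N -> cell s c `<=` cell w (ancestor s w c).
Proof.
move=> /subnK <-; elim: (s - w)%N c => [|m IH] c.
  by rewrite /ancestor subnn muln0 divn1.
rewrite addSn ancestorS ?leq_addl //.
exact: subset_trans (@cell_parent _ _) (IH _).
Qed.

Lemma ltn_parent s c : (c < 2 ^ (n * T s.+1))%N -> (parent s c < 2 ^ (n * T s))%N.
Proof. by move=> h; rewrite ltn_divLR ?expn_gt0 // -expnD -mulnDr. Qed.

Lemma ltn_ancestor s w c : (w <= s)%N -> (c < 2 ^ (n * T s))%N ->
  (ancestor s w c < 2 ^ (n * T w))%N.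
Proof.
move=> ws h; rewrite ltn_divLR ?expn_gt0 // -expnD -mulnDr.
by rewrite subnKC // total_exp_mono.
Qed.

Lemma eq_of_base_digits (K m c c' : nat) : (c %/ K ^ m = c' %/ K ^ m)%N ->
  (forall k, (k < m)%N -> (c %/ K ^ k) %% K = (c' %/ K ^ k) %% K)%N -> c = c'.
Proof.
elim: m => [|m IH] cc dcc; first by rewrite expn0 !divn1 in cc.
apply: IH => [|k km]; last by apply: dcc; exact: ltnW.
rewrite (divn_eq (c %/ K ^ m) K) (divn_eq (c' %/ K ^ m) K) -!divnMA -!expnSr.
by rewrite cc dcc.
Qed.

Lemma digit_inj s c c' : parent s c = parent s c' ->
  (forall k : 'I_n, digit s c k = digit s c' k) -> c = c'.
Proof.
rewrite /parent /digit mulnC expnM => pcc dcc.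
apply: eq_of_base_digits pcc _ => k kn.
by rewrite -expnM; exact: (dcc (Ordinal kn)).
Qed.

Lemma int_itv_eq (N : R) (a b y : R) : 0 < N ->
  N * a \is a Num.int -> N * b \is a Num.int ->
  a <= y < a + N^-1 -> b <= y < b + N^-1 -> a = b.
Proof.
move=> N0 /intrP[i iE] /intrP[j jE] ya yb.
have H (u v : R) (i' j' : int) : N * u = i'%:~R -> N * v = j'%:~R ->
    u < v + N^-1 -> (i' <= j')%R.
  move=> uE vE; rewrite -(ltr_pM2l N0) mulrDr mulfV ?gt_eqF // uE vE.
  by rewrite -[X in _ + X]/(1%:~R) -intrD ltr_int ltzD1.
have ij : i = j.
  apply/eqP; rewrite eq_le (H a b) ?(H b a) //; lra.
have N1 : N != 0 by rewrite gt_eqF.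
by apply: (mulfI N1); rewrite iE jE ij.
Qed.

Lemma grid_point_eq s c c' k : parent s c = parent s c' ->
  grid_point s c k = grid_point s c' k -> digit s c k = digit s c' k.
Proof.
rewrite /grid_point => -> /addrI /(mulIf _) /eqP.
by rewrite eqr_nat => H; apply/eqP/H; rewrite gt_eqF ?half_gt0.
Qed.

(** Both sides are the common coordinate rounded down to the grid, since a cell lies in the
    half-open grid box of its grid point. *)
Lemma grid_point_cell s c c' x x' (k : 'I_n) : cell s.+1 c x -> cell s.+1 c' x' ->
  x 0 k = x' 0 k -> grid_point s c k = grid_point s c' k.
Proof.
move=> xc xc' xx.
have E0 : 0 < 2 ^+ e s.+1 :> R by rewrite exprn_gt0.
have EV : (2 ^+ e s.+1)^-1 = half ^+ e s.+1 by rewrite exprVn.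
apply: (@int_itv_eq (2 ^+ e s.+1) _ _ (x 0 k)) => //; rewrite ?grid_point_int // EV.
  exact: cell_grid_point.
by rewrite xx; exact: cell_grid_point.
Qed.

(** By induction the parents agree; then [x] determines the grid point, hence the digits. *)
Lemma cell_disjoint s c c' x : (c < 2 ^ (n * T s))%N -> (c' < 2 ^ (n * T s))%N ->
  cell s c x -> cell s c' x -> c = c'.
Proof.
elim: s c c' => [|s IH] c c'; first by rewrite muln0 !ltnS !leqn0 => /eqP-> /eqP->.
move=> cT cT' xc xc'.
have pp : parent s c = parent s c'.
  by apply: IH; rewrite ?ltn_parent //; exact: cell_parent.
apply: (digit_inj pp) => k; apply: grid_point_eq pp _.
exact: grid_point_cell xc xc' _.
Qed.

(* A grid point lies in the cell of its parent, so grid points at one level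
   determine the cell. *)
Lemma grid_point_inj s c c' :
  (c < 2 ^ (n * T s.+1))%N -> (c' < 2 ^ (n * T s.+1))%N ->
  (forall k : 'I_n, grid_point s c k = grid_point s c' k) -> c = c'.
Proof.
move=> cT cT' cc.
have pc c1 : cell s (parent s c1) (\row_k grid_point s c1 k).
  move=> k; rewrite mxE; have [] := grid_point_bounds s c1 k.
  have := half_gt0 (e s.+1); lra.
have pp : parent s c = parent s c'.
  apply: (@cell_disjoint s _ _ (\row_k grid_point s c k)); rewrite ?ltn_parent //.
  have -> : (\row_(k < n) grid_point s c k) = \row_k grid_point s c' k :> 'rV[R]_n.
    by apply/rowP => k; rewrite !mxE.
  exact: pc.
by apply: (digit_inj pp) => k; apply: grid_point_eq pp _.
Qed.

Definition cantor_set : set 'rV[R]_n :=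
  [set x | forall s, exists2 c, (c < 2 ^ (n * T s))%N & cell s c x].

Lemma cell_compact s c : compact (cell s c).
Proof.
have -> : cell s c = [set x : 'rV[R]_n | forall k : 'I_n,
    `[corner s c k, corner s c k + half ^+ f s]%classic (x ord0 k)].
  by apply/seteqP; split=> x xc k; have := xc k; rewrite /= in_itv.
have := @rV_compact R n (fun k => `[corner s c k, corner s c k + half ^+ f s]%classic).
by apply => k; exact: segment_compact.
Qed.

Lemma cantor_set_compact : compact cantor_set.
Proof.
apply: (@subclosed_compact _ _ (cell 0 0)).
- have -> : cantor_set =
      \bigcap_s \big[setU/set0]_(c <- iota 0 (2 ^ (n * T s))) cell s c.
    apply/seteqP; split=> x xE s.
      move=> _; have [c cT xc] := xE s; rewrite -bigcup_seq; exists c => //=.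
      by rewrite mem_iota.
    have := xE s I; rewrite -bigcup_seq => -[c /=]; rewrite mem_iota => cT xc.
    by exists c.
  apply: closed_bigI => s _; apply: closed_bigsetU => c _.
  by apply: compact_closed; [exact: norm_hausdorff|exact: cell_compact].
- exact: cell_compact.
- move=> x /(_ 0%N)[c]; rewrite muln0 ltnS leqn0 => /eqP ->; exact.
Qed.

End Cells.

Lemma mxvec_index_eq (m n : nat) (i i' : 'I_m) (j j' : 'I_n) :
  (mxvec_index i j == mxvec_index i' j') = (i == i') && (j == j').
Proof.
apply/eqP/andP => [|[/eqP-> /eqP->//]].
(* The matrix whose entries are their own indices recovers [i] and [j] from the index. *)
move/(congr1 (mxvec (\matrix_(a < m, b < n) (a, b)) 0)).
by rewrite !mxvecE !mxE => -[-> ->].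
Qed.

(** * Avoiding the zeros of polynomials *)

Section Avoidance.
Variables (R : realType) (n d : nat).
Hypothesis d_gt0 : (0 < d)%N.
Local Notation half := (2^-1 : R).

Lemma expr_small (q eps : R) : 0 <= q < 1 -> 0 < eps ->
  exists S : nat, forall s, (S <= s)%N -> q ^+ s <= eps.
Proof.
move=> /andP[q0 q1] eps0; have := @cvg_expr R q; rewrite ger0_norm // => /(_ q1).
move=> /cvgrPdist_le /(_ _ eps0) [S _ HS]; exists S => s /HS /=.
by rewrite sub0r normrN ger0_norm ?exprn_ge0.
Qed.

Lemma half_small (eps : R) : 0 < eps -> exists S : nat, half ^+ S <= eps.
Proof.
move=> /(expr_small (q := half))[|S /(_ S (leqnn S)) HS]; last by exists S.
by rewrite invr_ge0 ler0n invf_lt1 // ltr1n.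
Qed.

(** Allows one point of a tuple to be shifted without the others; it holds because the sides of the
    cells tend to 0. *)
Lemma cells_separate (x y : 'rV[R]_n) : x != y ->
  exists W : nat, forall w c, (W <= w)%N ->
    cell d w c x -> ~ cell d w c y.
Proof.
move=> xy; have [k xyk] : exists k : 'I_n, x 0 k != y 0 k.
  apply/existsP; apply: contraR xy => /existsPn xy; apply/eqP/rowP => k.
  exact/eqP/negPn/xy.
have /half_small[W HW] : 0 < `|x 0 k - y 0 k| / 2.
  by rewrite divr_gt0 // normr_gt0 subr_eq0.
exists W => w c Ww /(_ k) xc /(_ k) yc.
have : half ^+ side_exp d w <= half ^+ W.
  by apply: half_mono; apply: leq_trans Ww _; exact: leq_side_exp.
have : 0 < `|x 0 k - y 0 k| by rewrite normr_gt0 subr_eq0.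
have : `|x 0 k - y 0 k| <= half ^+ side_exp d w.
  by rewrite ler_norml; apply/andP; split; lra.
lra.
Qed.

Lemma cantor_set_avoids (m : nat) (x : 'I_m -> 'rV[R]_n) (p : mpoly (m * n) rat) :
  injective x -> (forall i, cantor_set d (x i)) ->
  p != 0 -> (mmeasure mdeg p <= d.+1)%N -> eval_points p x != 0.
Proof.
move=> x_inj xE; rewrite /eval_points; set v := fun k => _.
have [N pN] := ubnP (mmeasure mdeg p); elim: N p pN => // N IH p pN p0 pd.
have [[c c0 ->]|[l lp]] := constant_or_mderiv_neq0 p0.
  by rewrite map_mpolyC mevalC fmorph_eq0.
have pl := msize_mderiv_lt l p0.
(* The derivative has smaller degree, so by induction it does not vanish at the tuple. *)
have dl := IH _ (leq_trans pl pN) lp (leq_trans (ltnW pl) pd).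
have [eps eps0 key] := shifted_grid_point_neq0 pd dl.
case/mxvec_indexP: l key {lp pl dl} => i k key.
have [W HW] : exists W : 'I_m -> nat, forall i', i' != i -> forall w c,
    (W i' <= w)%N -> cell d w c (x i) -> ~ cell d w c (x i').
  apply: (@fin_all_exists _ (fun=> nat) (fun i' W => i' != i -> forall w c,
    (W <= w)%N -> cell d w c (x i) -> ~ cell d w c (x i'))) => i'.
  have [->|ii'] := eqVneq i' i; first by exists 0%N.
  have [|W HW] := @cells_separate (x i) (x i'); last by exists W.
  by apply: contra_neq ii' => /x_inj.
pose w := (\max_i W i)%N.
have [cw cwT xcw] := xE i w.
have [S HS] := half_small eps0.
(* A late stage whose task shifts the descendants of the cell of [x i] along [k]; the lower bound is
   positive, so the stage is a successor and has grid points. *)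
have [[//|s] Ss ts] := task_recurs (w, cw, nat_of_ord k) (maxn S w).+1.
have {Ss} [Ss ws] : (S <= s.+1 /\ w <= s.+1)%N by split; lia.
have [c Hc] : exists c : 'I_m -> nat, forall i',
    (c i' < 2 ^ (n * total_exp d s.+1))%N /\ cell d s.+1 (c i') (x i').
  apply: (@fin_all_exists _ (fun=> nat) (fun i' c =>
    (c < 2 ^ (n * total_exp d s.+1))%N /\ cell d s.+1 c (x i'))) => i'.
  by have [c ? ?] := xE i' s.+1; exists c.
have Heps : half ^+ s.+1 <= eps by apply: le_trans HS; exact: half_mono.
have gE : half ^+ side_exp d s.+1 = half ^+ s.+1 * half ^+ shift_exp d s.+1.
  by rewrite -exprD -shift_exp_le_side_exp addnC.
(* With these choices [rho / t] and [t * N ^ d] both equal [half ^+ s.+1]. *)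
apply: (key (2 ^ grid_exp d s.+1)%N (half ^+ shift_exp d s.+1)
  (half ^+ side_exp d s.+1)
  (fun l => mxvec (\matrix_(i', k') grid_point R n d s (c i') k') 0 l)).
- by rewrite expn_gt0.
- rewrite half_gt0 (le_trans _ Heps) // half_mono //.
  by rewrite /shift_exp leq_addl.
- by rewrite gE ler_wpM2r ?half_ge0.
- rewrite natrX -exprM /shift_exp exprD [(d * _)%N]mulnC mulrAC [X in X * _]mulrC.
  by rewrite two_halfK mul1r.
- move=> l; case/mxvec_indexP: l => i' k'; rewrite mxvecE mxE natrX.
  exact: grid_point_int.
- move=> l; case/mxvec_indexP: l => i' k'; rewrite /v !mxvecE !mxE.
  have [ci'T xci'] := Hc i'.
  (* Only the variable of the chosen derivative is shifted: [c i] descends from [cw] by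
     disjointness, and by the choice of [w] no other [c i'] does. *)
  have -> : (mxvec_index i' k' == mxvec_index i k) = shifted n d s.+1 (c i') k'.
    rewrite /shifted ts ws /=.
    rewrite mxvec_index_eq.
    congr andb; have [->|ii'] := eqVneq i' i; last first.
      apply/esym/negP => /eqP ac; apply: (HW i' ii' w cw _ xcw).
        exact: (leq_bigmax (F := W)).
      by rewrite -ac; exact: cell_ancestor.
    have [ciT xci] := Hc i; apply/esym/eqP.
    exact: (cell_disjoint d_gt0 (ltn_ancestor ws ciT) cwT
      (cell_ancestor d_gt0 ws xci) xcw).
  have := xci' k'; rewrite [corner _ _ _ s.+1 _ _]/= -/(grid_point R n d s (c i') k').
  by move: (_%:R * _) => sh; lra.
Qed.

End Avoidance.

(* Without this, [edist] would be the extended distance of MathComp-Analysis. *)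
Local Notation edist := Defs.edist.

(** * Bounding Hausdorff measures from above and below *)

Section HausdorffDimension.
Variables (R : realType) (n : nat).
Implicit Types (A U : set 'rV[R]_n) (x y : 'rV[R]_n).

Lemma coord_le_edist x y k : `|x 0 k - y 0 k| <= edist x y.
Proof.
rewrite /edist -sqrtr_sqr; apply: ler_wsqrtr.
by rewrite (bigD1 k) //= lerDl sumr_ge0 // => i _; exact: sqr_ge0.
Qed.

Lemma edist_le_coord x y (r : R) : 0 <= r ->
  (forall k, `|x 0 k - y 0 k| <= r) -> edist x y <= Num.sqrt n%:R * r.
Proof.
move=> r0 xy; rewrite /edist -[X in _ * X](ger0_norm r0) -sqrtr_sqr -sqrtrM ?ler0n //.
apply: ler_wsqrtr; rewrite -[X in X%:R]card_ord mulr_natl -sumr_const.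
by apply: ler_sum => i _; rewrite -real_normK ?num_real // lerXn2r ?nnegrE.
Qed.

Lemma diam_ge0 U : (0 <= diam U)%E.
Proof. by rewrite /diam le_max lexx. Qed.

Lemma edist_le_diam U x y : U x -> U y -> ((edist x y)%:E <= diam U)%E.
Proof.
move=> Ux Uy; rewrite /diam le_max; apply/orP; right.
by apply: ereal_sup_ubound; exists (x, y).
Qed.

Lemma diam_le U (r : R) : 0 <= r ->
  (forall x y, U x -> U y -> edist x y <= r) -> (diam U <= r%:E)%E.
Proof.
move=> r0 Ur; rewrite /diam ge_max lee_fin r0 /=; apply: ge_ereal_sup.
by move=> _ [[x y] [/= Ux Uy] <-]; rewrite lee_fin; exact: Ur.
Qed.

Lemma diam_set0 : diam (set0 : set 'rV[R]_n) = 0%E.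
Proof. by apply/eqP; rewrite eq_le diam_ge0 diam_le. Qed.

Lemma hausdorff_dim_eq A (a : R) : 0 <= a ->
  (forall t, a < t -> hausdorff_measure t A = 0%E) ->
  (forall t, 0 <= t < a -> hausdorff_measure t A <> 0%E) ->
  hausdorff_dim A = a%:E.
Proof.
move=> a0 up low; apply/eqP; rewrite eq_le; apply/andP; split.
  apply/lee_addgt0Pr => eps eps0; apply: ereal_inf_lbound; exists (a + eps) => //=.
  by split; [rewrite addr_ge0 // ltW|apply: up; rewrite ltrDl].
apply: le_ereal_inf_tmp => _ [t [t0 tA] <-]; rewrite lee_fin leNgt.
by apply/negP => ta; apply: (low t) => //; rewrite t0.
Qed.

Lemma hausdorff_premeasure_ge0 t delta A : (0 <= hausdorff_premeasure t delta A)%E.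
Proof.
apply: le_ereal_inf_tmp => _ [U _ <-].
by apply: nneseries_ge0 => k _ _; exact: poweR_ge0.
Qed.

Lemma hausdorff_measure_eq0 t A : 0 < t ->
  (forall delta eta : R, 0 < delta -> 0 < eta ->
     exists (N : nat) (V : nat -> set 'rV[R]_n) (r : R),
     [/\ 0 <= r <= delta, N%:R * r `^ t <= eta,
         forall i, (diam (V i) <= r%:E)%E
       & A `<=` \bigcup_(i < N) V i]) ->
  hausdorff_measure t A = 0%E.
Proof.
move=> t0 H; apply/eqP; rewrite eq_le; apply/andP; split; last first.
  apply: le_trans (hausdorff_premeasure_ge0 t 1 A) _.
  by apply: ereal_sup_ubound; exists 1 => //=; exact: ltr01.
apply: ge_ereal_sup => _ [delta /= delta0 <-].
apply/lee_addgt0Pr => eta eta0; rewrite add0e.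
have [N [V [r [/andP[r0 rdelta] Nr Vr AV]]]] := H _ _ delta0 eta0.
apply: ge_ereal_inf.
(* Padding by empty sets, which the sum leaves out. *)
pose U i := if (i < N)%N then V i else set0.
exists (\sum_(0 <= k <oo | U k != set0) poweR (diam (U k)) t)%E.
  exists U => //; split.
    by move=> x /AV[i /= iN Vx]; exists i => //; rewrite /U iN.
  move=> k; rewrite /U; case: ifP => _; last by rewrite diam_set0 lee_fin ltW.
  by apply: le_trans (Vr k) _; rewrite lee_fin.
have count M : (\sum_(0 <= i < M | (i < N)%N) 1 = minn M N)%N.
  elim: M => [|M IH]; first by rewrite big_nil min0n.
  rewrite big_mkcond big_nat_recr //= -big_mkcond IH; case: ltnP; lia.
apply: lime_le; first by apply: is_cvg_nneseries => *; exact: poweR_ge0.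
near=> M; apply: (@le_trans _ _ (N%:R * r `^ t)%:E); last by rewrite lee_fin.
apply: (@le_trans _ _ (\sum_(0 <= k < M) (if (k < N)%N then (r `^ t)%:E else 0)))%E.
  rewrite big_mkcond; apply: lee_sum => k _; rewrite /U.
  case: (k < N)%N; last by rewrite eqxx.
  case: ifP => _; last by rewrite lee_fin powR_ge0.
  rewrite -poweR_EFin; apply: gt0_ler_poweR; rewrite ?(ltW t0) ?in_itv //=.
  - by rewrite diam_ge0 leey.
  - by rewrite lee_fin r0 leey.
rewrite -big_mkcond /= sumEFin lee_fin big_mkord sumr_const.
rewrite -[leLHS]mulr_natl ler_wpM2r ?powR_ge0 // ler_nat.
rewrite -sum1_card -(big_mkord (fun i => i < N)%N (fun=> 1%N)).
by rewrite count geq_minr.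
Unshelve. all: by end_near. Qed.

(** Countable subadditivity over the preimages of a cover gives 1 at most [C] times its sum, so the
    premeasure stays above [C^-1]. Preimages under [h] stand in for a mass carried by [A]. *)
Lemma mass_distribution_principle (T : Type) (mu : {outer_measure set T -> \bar R})
    (h : T -> 'rV[R]_n) (I : set T) A (t C delta : R) :
  0 < C -> 0 < delta -> (1 <= mu I)%E -> (forall u, I u -> A (h u)) ->
  (forall U, U !=set0 -> (diam U <= delta%:E)%E ->
     (mu (I `&` h @^-1` U) <= C%:E * poweR (diam U) t)%E) ->
  hausdorff_measure t A <> 0%E.
Proof.
move=> C0 delta0 I1 hA muC.
suff H : ((C^-1)%:E <= hausdorff_premeasure t delta A)%E.
  move=> H0; have : (hausdorff_premeasure t delta A <= hausdorff_measure t A)%E.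
    by apply: ereal_sup_ubound; exists delta.
  by rewrite H0 => /(le_trans H); rewrite lee_fin leNgt invr_gt0 C0.
apply: le_ereal_inf_tmp => _ [U [AU Udelta] <-].
have : (1 <= C%:E * \sum_(0 <= k <oo | U k != set0) poweR (diam (U k)) t)%E.
  rewrite -nneseriesZl; last by move=> k _; exact: poweR_ge0.
  apply: (le_trans I1).
  apply: (@le_trans _ _ (mu (\bigcup_k (I `&` h @^-1` U k)))).
    apply: le_outer_measure => u Iu; have [k _ Uk] := AU _ (hA u Iu).
    by exists k.
  apply: le_trans (outer_measure_sigma_subadditive mu _) _.
  rewrite [leRHS]eseries_mkcond; apply: lee_nneseries => k.
    by move=> _ _; exact: outer_measure_ge0.
  move=> _; case: ifPn => [/set0P Uk|/negPn/eqP ->]; first exact: muC.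
  by rewrite preimage_set0 setI0 outer_measure0.
set S := (\sum_(_ <= _ <oo | _) _)%E => CS.
have S0 : (0 <= S)%E by apply: nneseries_ge0 => k _ _; exact: poweR_ge0.
have := lee_wpmul2l (_ : (0 <= (C^-1)%:E)%E) CS.
rewrite mule1 muleA -EFinM mulVf ?gt_eqF // mul1e => -> //.
by rewrite lee_fin invr_ge0 ltW.
Qed.

End HausdorffDimension.

Lemma le_outer_measure_bigsetU (R : realType) (T : Type)
    (mu : {outer_measure set T -> \bar R}) (I : Type) (s : seq I) (P : pred I)
    (F : I -> set T) :
  (mu (\big[setU/set0]_(i <- s | P i) F i) <= \sum_(i <- s | P i) mu (F i))%E.
Proof.
elim/big_rec2: _ => [|i x A _ IH]; first by rewrite outer_measure0.
by apply: le_trans (outer_measureU2 mu _ _) _; rewrite leeD2l.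
Qed.

(** An outer measure, so that preimages of arbitrary covering sets can be measured. *)
Definition lebesgue_outer (R : realType) :
    {outer_measure set (ocitv_type R) -> \bar R} := ((wlength idfun)^*)%mu.

Lemma lebesgue_outer_itv (R : realType) (a b : R) : a <= b ->
  lebesgue_outer R (`[a, b[%classic : set R) = (b - a)%:E.
Proof.
move=> ab; transitivity (lebesgue_measure ([set` `[a, b[] : set R)) => //.
rewrite lebesgue_measure_itv /= lte_fin; case: ltP => [//|ba].
by have -> : b = a by [apply/eqP; rewrite eq_le ab ba]; rewrite subrr.
Qed.

(** * Binary coding of the cells and measure of preimages *)

Section Dimension.
Variables (R : realType) (n d : nat).
Hypothesis d_gt0 : (0 < d)%N.

Local Notation e := (grid_exp d).
Local Notation f := (side_exp d).
Local Notation br := (branch_exp d).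
Local Notation T := (total_exp d).
Local Notation half := (2^-1 : R).

(** The first [n * T s] binary digits of [u], read as the number of a cell. *)
Definition address (s : nat) (u : R) : nat := Num.truncn (u * 2 ^+ (n * T s)).

Lemma address_bounds s u : 0 <= u ->
  (address s u)%:R <= u * 2 ^+ (n * T s) < (address s u).+1%:R.
Proof. by move=> u0; apply: truncn_itv; rewrite mulr_ge0. Qed.

Lemma address_lt s u : 0 <= u < 1 -> (address s u < 2 ^ (n * T s))%N.
Proof.
move=> /andP[u0 u1]; have /andP[h _] := address_bounds s u0.
rewrite -(ltr_nat R) natrX; apply: le_lt_trans h _.
by rewrite gtr_pMl // exprn_gt0.
Qed.

(** Passing to the parent drops the last [n * br s] binary digits. *)
Lemma parent_address s u : 0 <= u -> parent n d s (address s.+1 u) = address s u.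
Proof.
move=> u0; apply/esym/truncn_def.
have /andP[h1 h2] := address_bounds s.+1 u0.
set c := address _ _ in h1 h2 *.
have K0 : 0 < (2 ^ (n * br s))%:R :> R by rewrite ltr0n expn_gt0.
have uE : u * 2 ^+ (n * T s.+1) = u * 2 ^+ (n * T s) * (2 ^ (n * br s))%:R.
  by rewrite natrX -mulrA -exprD -mulnDr.
rewrite uE in h1 h2; rewrite /parent; apply/andP; split.
  rewrite -(ler_pM2r K0) -natrM; apply: le_trans h1.
  by rewrite ler_nat leq_divM.
rewrite -(ltr_pM2r K0) -natrM; apply: lt_le_trans h2 _.
by rewrite ler_nat ltn_ceil // expn_gt0.
Qed.

(** The common point of the nested cells addressed by [u]; their corners increase in each
    coordinate. *)
Definition coding (u : R) : 'rV[R]_n :=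
  \row_k sup [set corner R n d s (address s u) k | s in [set: nat]].

Lemma corner_address_mono u k s m : 0 <= u ->
  corner R n d s (address s u) k <= corner R n d (m + s) (address (m + s) u) k
  /\ corner R n d (m + s) (address (m + s) u) k + half ^+ f (m + s)
     <= corner R n d s (address s u) k + half ^+ f s.
Proof.
move=> u0; elim: m => [|m [IH1 IH2]]; first by rewrite add0n.
have [] := @cell_corner_nested R n d d_gt0 (m + s) (address (m + s).+1 u) k.
rewrite parent_address // addSn => h1 h2.
by split; [exact: le_trans IH1 h1|exact: le_trans h2 IH2].
Qed.

Lemma coding_cell s u : 0 <= u -> cell d s (address s u) (coding u).
Proof.
move=> u0 k; rewrite mxE.
set A := [set _ | _ in _].
have Aub : ubound A (corner R n d s (address s u) k + half ^+ f s).
  move=> _ [s' _ <-]; have [ss'|/ltnW s's] := leqP s s'.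
    have [_] := corner_address_mono k s (s' - s) u0; rewrite subnK //.
    by apply: le_trans; rewrite lerDl half_ge0.
  have [+ _] := corner_address_mono k s' (s - s') u0; rewrite subnK //.
  by move=> /le_trans; apply; rewrite lerDl half_ge0.
have As : A (corner R n d s (address s u) k) by exists s.
apply/andP; split.
  by apply: ub_le_sup => //; exists (corner R n d s (address s u) k + half ^+ f s).
by apply: ge_sup => //; exists (corner R n d s (address s u) k).
Qed.

Lemma coding_cantor_set u : 0 <= u < 1 -> cantor_set d (coding u).
Proof.
move=> u01 s; exists (address s u); first exact: address_lt.
by apply: coding_cell; case/andP: u01.
Qed.

(** In each coordinate the integer positions of these grid points differ by at most [J] from those
    of one fixed cell, leaving [2 * J + 1] values, and grid points determine cells. *)
Lemma card_cells_meeting (U : set 'rV[R]_n) (s J : nat)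
    (S : {set 'I_(2 ^ (n * T s.+1))}) :
  (forall x y k, U x -> U y -> 2 ^+ e s.+1 * `|x 0 k - y 0 k| < J%:R) ->
  (forall c, c \in S -> exists2 x, U x & cell d s.+1 c x) ->
  (#|S| <= (2 * J).+1 ^ n)%N.
Proof.
move=> UJ SU.
have [->|/set0Pn[c0 c0S]] := eqVneq S finset.set0; first by rewrite cards0.
pose z (c : 'I_(2 ^ (n * T s.+1))) (k : 'I_n) : int :=
  Num.floor (2 ^+ e s.+1 * grid_point R n d s c k).
have zE c k : (z c k)%:~R = 2 ^+ e s.+1 * grid_point R n d s c k.
  by rewrite /z floorK // grid_point_int.
have E0 : 0 < 2 ^+ e s.+1 :> R by rewrite exprn_gt0.
have zdist c k : c \in S -> (`|z c k - z c0 k| <= J%:Z)%R.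
  move=> cS; have [x Ux xc] := SU c cS; have [y Uy yc] := SU c0 c0S.
  have := UJ x y k Ux Uy; rewrite -[X in X * `|_|](gtr0_norm E0) -normrM mulrBr.
  have scale (c1 : 'I_(2 ^ (n * T s.+1))) (w : 'rV[R]_n) : cell d s.+1 c1 w ->
      (z c1 k)%:~R <= 2 ^+ e s.+1 * w 0 k < (z c1 k)%:~R + 1.
    move=> /(cell_grid_point d_gt0 k)/andP[h1 h2]; apply/andP; split.
      by rewrite zE ler_pM2l.
    by move: h2; rewrite -(ltr_pM2l E0) mulrDr two_halfK zE.
  move: (scale _ _ xc) (scale _ _ yc); move: (_ * x 0 k) (_ * y 0 k) => X Y h1 h2 h3.
  (* Rounding both coordinates down costs less than 1 in the difference, and an integer below
     [J + 1] is at most [J]. *)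
  have : `|(z c k - z c0 k)%:~R| < J%:R + 1 :> R.
    by rewrite intrB ltr_norml; move: h3; rewrite ltr_norml => h3; apply/andP; split; lra.
  have -> : J%:R + 1 = (J%:Z + 1)%:~R :> R by rewrite intrD.
  by rewrite -intr_norm ltr_int ltzD1.
pose G (c : 'I_(2 ^ (n * T s.+1))) : {ffun 'I_n -> 'I_(2 * J).+1} :=
  [ffun k => inord (absz (z c k - z c0 k + J%:Z))].
have -> : ((2 * J).+1 ^ n = #|{ffun 'I_n -> 'I_(2 * J).+1}|)%N.
  by rewrite card_ffun !card_ord.
rewrite -(@card_in_imset _ _ G); first exact: max_card.
move=> c c' cS c'S Gcc; apply: val_inj.
apply: (grid_point_inj d_gt0 (R := R) (ltn_ord c) (ltn_ord c')) => k.
have := zdist c k cS; have := zdist c' k c'S.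
have /(congr1 (fun g : {ffun 'I_n -> 'I_(2 * J).+1} => val (g k))) := Gcc.
rewrite !ffunE /= => + h1 h2.
rewrite !inordK; try lia.
move=> h; have zz : z c k = z c' k by lia.
by apply: (mulfI (lt0r_neq0 E0)); rewrite -!zE zz.
Qed.

Lemma half_powR m : half ^+ m = 2 `^ (- m%:R).
Proof. by rewrite powRN powR_mulrn // exprVn. Qed.

(** Bounds the mass [half ^+ (n * T s)] of a cell by a constant times the [t]-th power of its side.
    The gain [gam * e s.+1] eventually beats the loss [B * (e s + 1)] inherited from earlier levels;
    [C] absorbs the first levels. *)
Lemma side_exp_le_total_exp (t : R) : 0 <= t -> t * d%:R < n%:R ->
  exists2 C : R, 0 <= C & forall s, t * (f s)%:R <= n%:R * (T s)%:R + C.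
Proof.
move=> t0 td; pose gam := n%:R - t * d%:R.
have gam0 : 0 < gam by rewrite subr_gt0.
pose B := n%:R * d%:R + 2 * n%:R + 2 * t.
have B0 : 0 <= B by rewrite !addr_ge0 ?mulr_ge0.
(* Once [e s.+1] is at least [s0.+1] times [e s + 1], the gain exceeds the loss. *)
pose s0 := Num.truncn (B / gam).
have Bs0 : B < gam * s0.+1%:R by rewrite mulrC -ltr_pdivrMr // truncnS_gt.
clearbody s0; exists (B * (e s0.+1).+1%:R) => [|s]; first exact: mulr_ge0.
case: s => [|s]; first by rewrite /side_exp /= muln0 mulr0 addr_ge0 ?mulr_ge0.
have fE : (f s.+1)%:R = d%:R * (e s.+1)%:R + 2 * s.+1%:R :> R.
  by rewrite /side_exp natrD !natrM.
have fE' : (f s)%:R = d%:R * (e s)%:R + 2 * s%:R :> R.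
  by rewrite /side_exp natrD !natrM.
have Tle : (e s.+1)%:R - (f s)%:R <= (T s.+1)%:R :> R.
  rewrite lerBlDr -natrD ler_nat /=; have := branch_expE d s => /=; lia.
have es : s%:R <= (e s)%:R :> R by rewrite ler_nat leq_grid_exp.
have es1 : s.+1%:R <= (e s)%:R + 1 :> R by rewrite -natr1 lerD2r.
have e0 : 0 <= (e s)%:R :> R by [].
have loss : n%:R * (f s)%:R + 2 * t * s.+1%:R <= B * ((e s)%:R + 1).
  rewrite fE' /B.
  have h1 : n%:R * s%:R <= n%:R * (e s)%:R :> R by rewrite ler_wpM2l.
  have h2 : t * s.+1%:R <= t * ((e s)%:R + 1) by rewrite ler_wpM2l.
  have h3 : 0 <= n%:R * d%:R :> R by rewrite mulr_ge0.
  have h4 : 0 <= n%:R :> R by [].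
  have -> : n%:R * (d%:R * (e s)%:R + 2 * s%:R) + 2 * t * s.+1%:R =
     n%:R * d%:R * (e s)%:R + 2 * (n%:R * s%:R) + 2 * (t * s.+1%:R) by ring.
  have -> : (n%:R * d%:R + 2 * n%:R + 2 * t) * ((e s)%:R + 1) =
     n%:R * d%:R * (e s)%:R + n%:R * d%:R + 2 * (n%:R * (e s)%:R) + 2 * n%:R
     + 2 * (t * ((e s)%:R + 1)) by ring.
  lra.
have nT : n%:R * ((e s.+1)%:R - (f s)%:R) <= n%:R * (T s.+1)%:R :> R.
  by rewrite ler_wpM2l.
have split_le : t * (f s.+1)%:R + gam * (e s.+1)%:R <=
    n%:R * (T s.+1)%:R + B * ((e s)%:R + 1).
  have -> : t * (f s.+1)%:R + gam * (e s.+1)%:R =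
    n%:R * ((e s.+1)%:R - (f s)%:R) + (n%:R * (f s)%:R + 2 * t * s.+1%:R).
    by rewrite fE /gam; ring.
  exact: lerD.
have ge0 : 0 <= gam * (e s.+1)%:R by rewrite mulr_ge0 // ltW.
have [ss0|s0s] := leqP s s0.+1.
  have : B * ((e s)%:R + 1) <= B * (e s0.+1).+1%:R.
    by rewrite -natr1 ler_wpM2l // lerD2r ler_nat grid_exp_mono.
  lra.
have eS : s0.+1%:R * ((e s)%:R + 1) <= (e s.+1)%:R :> R.
  rewrite natr1 -natrM ler_nat; apply: leq_mul_grid_exp.
  by clear -s0s; lia.
have : B * ((e s)%:R + 1) <= gam * (e s.+1)%:R.
  apply: (@le_trans _ _ (gam * s0.+1%:R * ((e s)%:R + 1))).
    by rewrite ler_wpM2r ?addr_ge0 // ltW.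
  by rewrite -mulrA ler_wpM2l // ltW.
have : 0 <= B * (e s0.+1).+1%:R by rewrite mulr_ge0.
lra.
Qed.

Lemma scale_exists (D : R) : 0 < D < 1 ->
  exists s, half ^+ f s.+1 <= D <= half ^+ f s.
Proof.
move=> /andP[D0 D1].
have ex : exists s, half ^+ f s <= D.
  have [S HS] := half_small D0; exists S; apply: le_trans HS; apply: half_mono.
  exact: leq_side_exp.
case: (ex_minnP ex) => -[|s] sD smin.
  by move: sD; rewrite /side_exp /= muln0 expr0 leNgt D1.
exists s; rewrite sD /= leNgt; apply/negP => /ltW /smin; by rewrite ltnn.
Qed.

(** With [D] between the sides of levels [s.+1] and [s], the cells of level [s.+1] meeting [U] are
    counted and each contributes its dyadic interval. *)
Lemma coding_preimage_measure (t : R) : 0 <= t -> t * d%:R < n%:R ->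
  exists2 C : R, 0 < C & forall (D : R) (U : set 'rV[R]_n), 0 < D < 1 ->
    (forall x y k, U x -> U y -> `|x 0 k - y 0 k| <= D) ->
    (lebesgue_outer R (`[0%R, 1%R[%classic `&` coding @^-1` U)
       <= (C * D `^ t)%:E)%E.
Proof.
move=> t0 td; have [C0 C00 HC] := side_exp_le_total_exp t0 td.
have tn : t <= n%:R.
  by apply: le_trans (ltW td); rewrite ler_peMr // ler1n.
have two1 : 1 <= 2 :> R by rewrite ler1n.
exists (5 ^+ n * 2 `^ C0); first by rewrite mulr_gt0 ?exprn_gt0 ?powR_gt0.
move=> D U /[dup] D01 /andP[D0 D1] UD; have [s /andP[sD Ds]] := scale_exists D01.
pose S := [set c : 'I_(2 ^ (n * T s.+1)) | `[< exists2 x, U x & cell d s.+1 c x >]]%SET.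
pose F (c : 'I_(2 ^ (n * T s.+1))) : set R :=
  `[c%:R * half ^+ (n * T s.+1), c.+1%:R * half ^+ (n * T s.+1)[%classic.
have cover : `[0%R, 1%R[%classic `&` coding @^-1` U `<=` \big[setU/set0]_(c in S) F c.
  move=> u [/=]; rewrite in_itv /= => u01 Uu.
  have u0 : 0 <= u by case/andP: u01.
  have aT := address_lt s.+1 u01.
  rewrite -bigcup_seq_cond; exists (Ordinal aT) => /=.
    rewrite mem_index_enum inE; apply/asboolP; exists (coding u) => //.
    exact: coding_cell.
  have /andP[h1 h2] := address_bounds s.+1 u0.
  have E0 : 0 < 2 ^+ (n * T s.+1) :> R by rewrite exprn_gt0.
  rewrite /F /= in_itv /= -(ler_pM2r E0) -(ltr_pM2r E0) -!mulrA.
  by rewrite ![half ^+ _ * _]mulrC two_halfK !mulr1 h1.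
apply: le_trans (le_outer_measure _ _ _ cover) _.
apply: le_trans (le_outer_measure_bigsetU _ _ _ _) _.
have FE c : lebesgue_outer R (F c) = (half ^+ (n * T s.+1))%:E.
  rewrite lebesgue_outer_itv.
    by rewrite -mulrBl -natr1 addrAC subrr add0r mul1r.
  by rewrite ler_wpM2r ?half_ge0 // ler_nat.
under eq_bigr do rewrite FE.
rewrite sumEFin lee_fin sumr_const -[leLHS]mulr_natl.
set y := 2 ^+ e s.+1 * D.
have y0 : 0 < y by rewrite mulr_gt0 // exprn_gt0.
(* With [J] one more than the integer part of [y], [2 * J + 1] is at most [2 * y + 3], hence the
   5. *)
have cardS : #|S|%:R <= (5 * Num.max 1 y) ^+ n.
  apply: (@le_trans _ _ (((2 * (Num.truncn y).+1).+1 ^ n)%N)%:R).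
    rewrite ler_nat; apply: (@card_cells_meeting U s _ S).
      move=> x x' k Ux Ux'; apply: le_lt_trans (truncnS_gt y).
      by rewrite ler_wpM2l ?exprn_ge0 //; exact: UD.
    by move=> c; rewrite inE => /asboolP.
  rewrite natrX lerXn2r ?nnegrE ?mulr_ge0 //; first by rewrite le_max ler01.
  have : (Num.truncn y)%:R <= y by rewrite truncn_le ltW.
  have -> : (2 * (Num.truncn y).+1).+1%:R = 2 * ((Num.truncn y)%:R + 1) + 1 :> R.
    by rewrite natr1 -natrM natr1.
  move: (Num.truncn y)%:R => q qy.
  have : 1 <= Num.max 1 y by rewrite le_max lexx.
  have : y <= Num.max 1 y by rewrite le_max lexx orbT.
  lra.
apply: le_trans (ler_wpM2r (half_ge0 _ _) cardS) _.
rewrite exprMn -!mulrA ler_wpM2l ?exprn_ge0 //.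
have tn0 : 0 <= n%:R - t by rewrite subr_ge0.
(* Below the grid step the count is bounded, and [D] is compared with the side at level [s.+1]. *)
have [y1|y1] := leP y 1.
  rewrite expr1n mul1r.
  apply: (@le_trans _ _ (2 `^ C0 * (half ^+ f s.+1) `^ t)); last first.
    by rewrite ler_wpM2l ?powR_ge0 // ge0_ler_powR ?nnegrE ?half_ge0 ?(ltW D0).
  rewrite !half_powR -powRrM -powRD ?pnatr_eq0 ?implybT // ler_powR //.
  have := HC s.+1; rewrite natrM; lra.
rewrite /y exprMn.
(* Above the grid step, [D ^+ n] is split so that the spare factor is bounded by the side at level
   [s]; the exponents then reduce to the estimate at level [s]. *)
have -> : D ^+ n = D `^ t * D `^ (n%:R - t).
  rewrite -powR_mulrn ?(ltW D0) // -powRD; last by rewrite (gt_eqF D0) implybT.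
  by rewrite addrC subrK.
apply: (@le_trans _ _ ((2 ^+ e s.+1) ^+ n * (D `^ t * (half ^+ f s) `^ (n%:R - t))
    * half ^+ (n * T s.+1))).
  rewrite ler_wpM2r ?half_ge0 // ler_wpM2l ?exprn_ge0 // ler_wpM2l ?powR_ge0 //.
  by rewrite ge0_ler_powR ?nnegrE ?half_ge0 ?(ltW D0).
have -> : (2 ^+ e s.+1) ^+ n * (D `^ t * (half ^+ f s) `^ (n%:R - t))
    * half ^+ (n * T s.+1) =
    ((2 ^+ e s.+1) ^+ n * (half ^+ f s) `^ (n%:R - t) * half ^+ (n * T s.+1)) * D `^ t.
  by ring.
rewrite ler_wpM2r ?powR_ge0 // -exprM -powR_mulrn // !half_powR -powRrM.
rewrite -!powRD ?pnatr_eq0 ?implybT // ler_powR //.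
have TE : (T s.+1)%:R = (T s)%:R + (e s.+1)%:R - (f s)%:R :> R.
  by rewrite -(branch_expE d s) /= !natrD; ring.
have -> : (e s.+1 * n)%:R + - (f s)%:R * (n%:R - t) + - (n * T s.+1)%:R =
   t * (f s)%:R - n%:R * (T s)%:R :> R.
  by rewrite (natrM R (e s.+1) n) (natrM R n (T s.+1)) TE; ring.
have := HC s; lra.
Qed.

End Dimension.

(** * The dimension of the set *)

Section CantorSetDimension.
Variables (R : realType) (n d : nat).
Hypotheses (n_gt0 : (0 < n)%N) (d_gt0 : (0 < d)%N).
Local Notation half := (2^-1 : R).

Lemma powR2N_lt1 (t : R) : 0 < t -> 0 <= 2 `^ (- t) < 1.
Proof.
move=> t0; rewrite powR_ge0 powRN invf_lt1 ?powR_gt0 //=.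
have h : (1 : R) < 2 by rewrite ltr1n.
have := gt0_ltr_powR t0 (_ : 1 \is Num.nneg) (_ : 2 \is Num.nneg) h.
by rewrite powR1 !nnegrE; apply.
Qed.

(** Treats diameter 0, where the previous estimate is applied with a positive exponent [t] and [D]
    tending to 0. *)
Lemma coding_preimage_null (U : set 'rV[R]_n) : diam U = 0%E ->
  lebesgue_outer R (`[0%R, 1%R[%classic `&` coding n d @^-1` U) = 0%E.
Proof.
move=> U0; apply/eqP; rewrite eq_le outer_measure_ge0 andbT.
pose t : R := n%:R / (2 * d%:R).
have d0 : 0 < d%:R :> R by rewrite ltr0n.
have n0 : 0 < n%:R :> R by rewrite ltr0n.
have t0 : 0 < t by rewrite divr_gt0 // mulr_gt0.
have td : t * d%:R < n%:R.
  rewrite /t invfM mulrA mulfVK ?gt_eqF // ltr_pdivrMr //; lra.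
have [C C0 HC] := coding_preimage_measure d_gt0 (ltW t0) td.
have two1 : 1 < 2 :> R by rewrite ltr1n.
have q1 := powR2N_lt1 t0.
apply/lee_addgt0Pr => eps eps0; rewrite add0e.
have [S HS] := expr_small q1 (divr_gt0 eps0 C0).
apply: le_trans (HC (half ^+ S.+1) U _ _) _.
- by rewrite half_gt0 exprn_ilt1 ?invr_ge0 ?invf_lt1.
- move=> x y k Ux Uy; apply: le_trans (coord_le_edist x y k) _.
  have := edist_le_diam Ux Uy; rewrite U0 lee_fin => /le_trans; apply.
  exact: half_ge0.
rewrite lee_fin mulrC -ler_pdivlMr //.
by rewrite half_powR -powRrM mulNr mulrC -mulNr powRrM powR_mulrn ?powR_ge0 ?HS.
Qed.

Lemma cantor_set_hausdorff_dim :
  hausdorff_dim (cantor_set d : set 'rV[R]_n) = (n%:R / d%:R)%:E.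
Proof.
have d0 : 0 < d%:R :> R by rewrite ltr0n.
have n0 : 0 < n%:R :> R by rewrite ltr0n.
have two1 : 1 < 2 :> R by rewrite ltr1n.
apply: hausdorff_dim_eq; first by rewrite divr_ge0.
- move=> t; rewrite ltr_pdivrMr // => ntd.
  have t0 : 0 < t by rewrite -(pmulr_lgt0 _ d0); exact: lt_trans ntd.
  apply: hausdorff_measure_eq0 => // delta eta delta0 eta0.
  pose gam := t * d%:R - n%:R.
  have gam0 : 0 < gam by rewrite subr_gt0.
  have w0 : 0 < Num.sqrt n%:R :> R by rewrite sqrtr_gt0.
  have wt0 : 0 < Num.sqrt n%:R `^ t :> R by rewrite powR_gt0.
  have q1 := powR2N_lt1 gam0.
  have h1 : 0 <= half < 1 by rewrite invr_ge0 ler0n invf_lt1.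
  have [S HS] := expr_small q1 (divr_gt0 eta0 wt0).
  have [S' HS'] := expr_small h1 (divr_gt0 delta0 w0).
  (* The cover consists of all cells of level [s]; as [total_exp] and [s] are at most [grid_exp],
     its sum is at most [Num.sqrt n%:R]^ t[times]2 [^ (- gam * s)]. *)
  pose s := maxn S S'.
  exists (2 ^ (n * total_exp d s))%N, (cell d s),
    (Num.sqrt n%:R * half ^+ side_exp d s); split.
  + rewrite mulr_ge0 ?half_ge0 ?sqrtr_ge0 //= mulrC -ler_pdivlMr //.
    exact: HS' (leq_trans (leq_maxr _ _) (leq_side_exp _ _)).
  + rewrite powRM ?half_ge0 ?sqrtr_ge0 // mulrCA mulrC -ler_pdivlMr //.
    apply: le_trans (HS s (leq_maxl _ _)).
    rewrite half_powR -powRrM natrX -powR_mulrn // -powRD; last first.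
      by rewrite pnatr_eq0 implybT.
    rewrite -powR_mulrn ?powR_ge0 // -powRrM ler_powR ?(ltW two1) //.
    have := total_exp_le_grid_exp d_gt0 s; have := leq_grid_exp d s.
    rewrite /side_exp; move: (total_exp d s) (grid_exp d s) => T e.
    rewrite -!(ler_nat R) natrD !natrM => se Te.
    have h2 : n%:R * T%:R <= n%:R * e%:R :> R by rewrite ler_wpM2l.
    have h3 : gam * s%:R <= gam * e%:R by rewrite ler_wpM2l // ltW.
    have h4 : 0 <= s%:R * t by rewrite mulr_ge0 // ltW.
    move: h3; rewrite /gam !mulrBl => h3.
    have -> : - (d%:R * e%:R + 2 * s%:R) * t = - (t * d%:R * e%:R) - 2 * (s%:R * t).
      by ring.
    have -> : - (t * d%:R - n%:R) * s%:R = n%:R * s%:R - t * d%:R * s%:R by ring.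
    lra.
  + move=> c; apply: diam_le; first by rewrite mulr_ge0 ?half_ge0 ?sqrtr_ge0.
    move=> x y xc yc; apply: edist_le_coord; first exact: half_ge0.
    move=> k; have := xc k; have := yc k.
    move: (corner _ _ _ _ _ _) => z h2 h3.
    by rewrite ler_norml; apply/andP; split; lra.
  + by move=> x /(_ s)[c cT xc]; exists c.
- move=> t /andP[t0]; rewrite ltr_pdivlMr // => td.
  have [C C0 HC] := coding_preimage_measure d_gt0 t0 td.
  (* The bound [half] on diameters ensures the [D < 1] required by [HC]. *)
  apply: (@mass_distribution_principle R n _ (lebesgue_outer R) (coding n d)
    `[0%R, 1%R[%classic _ t C half) => //.
  + by rewrite lebesgue_outer_itv // subr0.
  + by move=> u /=; rewrite in_itv; exact: coding_cantor_set.
  move=> U U0 Uhalf; have [UD|UD] := eqVneq (diam U) 0%E.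
    by rewrite coding_preimage_null // mule_ge0 ?poweR_ge0 // lee_fin ltW.
  have Ufin : diam U \is a fin_num.
    by rewrite ge0_fin_numE ?diam_ge0 //; exact: le_lt_trans Uhalf (ltry _).
  have D0 : 0 < fine (diam U).
    by rewrite -lte_fin fineK // lt_neqAle eq_sym UD diam_ge0.
  have D1 : fine (diam U) < 1.
    rewrite -lte_fin fineK //; apply: le_lt_trans Uhalf _.
    by rewrite lte_fin invf_lt1.
  rewrite -[diam U in leRHS]fineK // poweR_EFin -EFinM; apply: HC.
    by rewrite D0.
  move=> x y k Ux Uy; apply: le_trans (coord_le_edist x y k) _.
  by rewrite -lee_fin fineK //; exact: edist_le_diam.
Qed.

End CantorSetDimension.

Unset Implicit Arguments.

Theorem theorem2p3 (R : realType) (n : nat) (n_ge1 : (1 <= n)%N)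
    (J : Type) (J_countable : countable [set: J])
    (m : J -> nat) (m_gt0 : forall j, (0 < m j)%N)
    (P : forall j, mpoly (m j * n) rat)
    (P_neq0 : forall j, P j <> 0)
    (d : nat) (d_ge1 : (1 <= d)%N)
    (deg_le : forall j, (total_degree (P j) <= d)%N)
    (deg_max : exists j, total_degree (P j) = d) :
  exists E : set 'rV[R]_n,
    [/\ compact E,
        hausdorff_dim E = (n%:R / d%:R)%:E
      & forall j : J,
          ~ exists x : 'I_(m j) -> 'rV[R]_n,
              [/\ injective x, forall i, E (x i)
                & eval_points (P j) x = 0]].
Proof.
exists (cantor_set d); split.
- exact: cantor_set_compact.
- exact: cantor_set_hausdorff_dim.
move=> j [x [x_inj xE]]; apply/eqP; apply: (@cantor_set_avoids R n d) => //.
  exact/eqP/P_neq0.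
(* [total_degree] is a predecessor, which accounts for the [d.+1]. *)
by apply: leq_trans (leqSpred _) _; rewrite ltnS; exact: deg_le.
Qed.
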